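(* Let $N\ge0$ be an integer and let $a,b$ be real parameters that are generic, i.e. such that all expressions below are defined (no denominator vanishes). The rational functions $\mathcal U_m(n;a,b,N)$ and $\mathcal V_m(n;a,b,N)$ of Hahn type satisfy the biorthogonality relations $$\sum_{n=0}^N\mathcal W(n)\,\mathcal V_m(n;a,b,N)\,\mathcal U_{m'}(n;a,b,N)=h_m\,\delta_{m,m'}\qquad(m,m'=0,\dots,N),$$ $$\sum_{m=0}^N\mathcal W^*(m)\,\mathcal V_m(n;a,b,N)\,\mathcal U_m(n';a,b,N)=h_n^*\,\delta_{n,n'}\qquad(n,n'=0,\dots,N),$$ where $$h_m=\frac{(1,\,-N,\,m-N+b)_m\,(2m-N+b+1)_{N-2m}}{(b+1)_m\,(b-N+1)_N},\qquad \mathcal W(n)=\frac{(a-b-1)_{N-n}(1-a)_n}{(-b)_N}\,\frac{N!}{n!\,(N-n)!},$$ $$h_n^*=\frac{(1,\,2-a+b-N)_n}{(-N,\,1-a)_n},\qquad \mathcal W^*(m)=\frac{(2-a+b-N)_N\,(b+1)_m}{(1,\,-N,\,m+b-N)_m\,(2m+b-N+1)_{N-2m}}.$$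
   Context: Rational functions of Hahn type: for $m=0,\dots,N$, $$\mathcal U_m(x;a,b,N)=\frac{(-1)^m(-N)_m}{(b+1)_m}\sum_{\ell=0}^m\frac{(-x)_\ell(-m)_\ell(b+m-N)_\ell}{\ell!\,(-N)_\ell(a-x)_\ell},\qquad \mathcal V_m(x;a,b,N)=\mathcal U_m(N-x;b+2-a,b,N)$$ (the sum is ${}_3F_2(-x,-m,b+m-N;-N,a-x;1)$). Pochhammer symbols: $(x)_0=1$, $(x)_k=x(x+1)\cdots(x+k-1)$ for $k\ge1$, for negative index $(x)_{-k}=1/(x-k)_k$ (i.e. $(x)_j=\Gamma(x+j)/\Gamma(x)$), and $(x_1,\dots,x_r)_k=(x_1)_k\cdots(x_r)_k$. *)

(* Defs.v *)
From mathcomp Require Import all_boot all_order all_algebra.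

Set Implicit Arguments.
Unset Strict Implicit.
Unset Printing Implicit Defensive.

Import Order.TTheory GRing.Theory Num.Theory.
Local Open Scope ring_scope.

(* (x)_k for an integer index, with (x)_(-k) = 1 / (x - k)_k; recall that
   Negz k stands for -(k + 1). *)
Definition poch (R : fieldType) (x : R) (k : int) : R :=
  match k with
  | Posz k => \prod_(i < k) (x + i%:R)
  | Negz k => (\prod_(i < k.+1) (x - k.+1%:R + i%:R))^-1
  end.

(* (x_1, ..., x_r)_k *)
Definition pochs (R : fieldType) (s : seq R) (k : int) : R :=
  \prod_(x <- s) poch x k.

Definition hahnU (R : fieldType) (m : nat) (x a b : R) (N : nat) : R :=
  (-1) ^+ m * poch (- N%:R) m / poch (b + 1) m *
  \sum_(l < m.+1)
    (poch (- x) l * poch (- m%:R) l * poch (b + m%:R - N%:R) l) /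
    (l`!%:R * poch (- N%:R) l * poch (a - x) l).

Definition hahnV (R : fieldType) (m : nat) (x a b : R) (N : nat) : R :=
  hahnU m (N%:R - x) (b + 2 - a) b N.

Definition hahn_h (R : fieldType) (b : R) (N m : nat) : R :=
  (pochs [:: 1; - N%:R; m%:R - N%:R + b] m *
   poch (2 * m%:R - N%:R + b + 1) (N%:Z - (2 * m)%N%:Z)) /
  (poch (b + 1) m * poch (b - N%:R + 1) N).

Definition hahnW (R : fieldType) (a b : R) (N n : nat) : R :=
  (poch (a - b - 1) (N%:Z - n%:Z) * poch (1 - a) n) / poch (- b) N *
  (N`!%:R / (n`!%:R * (N - n)%N`!%:R)).

Definition hahn_hstar (R : fieldType) (a b : R) (N n : nat) : R :=
  pochs [:: 1; 2 - a + b - N%:R] n / pochs [:: - N%:R; 1 - a] n.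

Definition hahnWstar (R : fieldType) (a b : R) (N m : nat) : R :=
  (poch (2 - a + b - N%:R) N * poch (b + 1) m) /
  (pochs [:: 1; - N%:R; m%:R + b - N%:R] m *
   poch (2 * m%:R + b - N%:R + 1) (N%:Z - (2 * m)%N%:Z)).

(* No denominator vanishes in hahnU and hahnV at x = 0, ..., N, nor in the norms
   and weights, for indices up to N.  The denominators l!, (1)_l and (-N)_l with
   l <= N are omitted: they are never 0 in characteristic 0.  When N < 2m, a
   symbol (x)_(N - 2m) is itself the inverse of (x + N - 2m)_(2m - N), which is
   nonzero exactly when the symbol is, since 0^-1 = 0; so gen_WstarR also says
   that the symbol is well defined. *)
Record hahn_generic (R : fieldType) (a b : R) (N : nat) : Prop := HahnGeneric {
  gen_b1 : forall m : nat, (m <= N)%N -> poch (b + 1) m != 0;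
  gen_U : forall n l : nat, (n <= N)%N -> (l <= N)%N ->
    poch (a - n%:R) l != 0;
  gen_V : forall n l : nat, (n <= N)%N -> (l <= N)%N ->
    poch (b + 2 - a - (N%:R - n%:R)) l != 0;
  gen_h : poch (b - N%:R + 1) N != 0;
  gen_W : poch (- b) N != 0;
  gen_hstar : forall n : nat, (n <= N)%N -> poch (1 - a) n != 0;
  gen_WstarL : forall m : nat, (m <= N)%N -> poch (m%:R + b - N%:R) m != 0;
  gen_WstarR : forall m : nat, (m <= N)%N ->
    poch (2 * m%:R + b - N%:R + 1) (N%:Z - (2 * m)%N%:Z) != 0
}.

(* Main.v *)
(* The factor (-n)_l / (a-n)_l of U turns (1-a)_n / n! into
   (1-a)_(n-l) / (n-l)!, and likewise for V under n -> N - n, so by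
   Chu-Vandermonde the mixed moments of the weight W are
   (-N)_(k+l) / (b-N+1)_(k+l), independently of a.  Pairing the coefficients of
   U_m with the k-th moment row, k <= m, gives an alternating binomial sum
   sum_l (-1)^l C(m,l) p(l) / (y+l) with deg p = m, which equals
   m! p(-y) / (y)_(m+1) and vanishes unless k = m.  The second relation is the
   first one read as A B = 1, hence B A = 1, for square matrices. *)
Require Import Defs.
From mathcomp Require Import all_boot all_order all_algebra.
From mathcomp Require Import ring.

Set Implicit Arguments.
Unset Strict Implicit.
Unset Printing Implicit Defensive.

Import Order.TTheory GRing.Theory Num.Theory.
Local Open Scope ring_scope.

Local Arguments poch : simpl never.

(** * Pochhammer symbols over a field *)

Section Pochhammer.
Variable R : fieldType.
Implicit Types (x y : R) (m n k : nat).

Lemma poch_nat x n : poch x n = \prod_(i < n) (x + i%:R).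
Proof. by []. Qed.

Lemma poch0 x : poch x 0 = 1.
Proof. by rewrite poch_nat big_ord0. Qed.

Lemma pochSr x n : poch x n.+1 = poch x n * (x + n%:R).
Proof. by rewrite !poch_nat big_ord_recr. Qed.

Lemma pochD x m n : poch x (m + n)%N = poch x m * poch (x + m%:R) n.
Proof.
elim: n => [|n IHn]; first by rewrite addn0 poch0 mulr1.
by rewrite addnS !pochSr IHn natrD -mulrA addrA.
Qed.

Lemma pochSl x n : poch x n.+1 = x * poch (x + 1) n.
Proof. by rewrite -add1n pochD pochSr poch0 mul1r addr0. Qed.

Lemma poch_reflect x n : poch (- x) n = (-1) ^+ n * poch (x - n%:R + 1) n.
Proof.
elim: n x => [|n IHn] x; first by rewrite !poch0 mulr1.
rewrite pochSr IHn pochSl exprS -[n.+1]addn1 natrD.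
rewrite (_ : x - (n%:R + 1) + 1 = x - n%:R); last by ring.
by ring.
Qed.

Lemma poch1 n : poch (1 : R) n = n`!%:R.
Proof.
elim: n => [|n IHn]; first by rewrite poch0.
by rewrite pochSr IHn factS mulnC natrM -natr1 addrC.
Qed.

Lemma pochN_eq0 m n : (m < n)%N -> poch (- m%:R : R) n = 0.
Proof.
by move=> lt_mn; rewrite poch_nat (bigD1 (Ordinal lt_mn)) //= addNr mul0r.
Qed.

(** Stated as a product because [(m - n)!] may vanish in a general field. *)
Lemma pochN_fact m n : (n <= m)%N ->
  poch (- m%:R : R) n * (m - n)`!%:R = (-1) ^+ n * m`!%:R.
Proof.
move=> le_nm; rewrite poch_reflect -(natrB _ le_nm) -!poch1 -mulrA; congr (_ * _).
by rewrite -[in RHS](subnK le_nm) pochD mulrC [1 + _]addrC.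
Qed.

(** The index is [-m]: this treats the negative branch of [poch], met in [(2m - N + b + 1)_(N - 2m)]
    when [N < 2m]. *)
Lemma poch_subz x m n :
  poch (x + (n + m)%N%:R) (n%:Z - (n + m)%N%:Z) = (poch (x + n%:R) m)^-1.
Proof.
case: m => [|m]; first by rewrite addn0 subrr poch0 invr1.
rewrite (_ : _ - _ = Negz m); last by rewrite NegzE; ring.
by congr (_^-1); apply: eq_bigr => i _; rewrite natrD; ring.
Qed.

End Pochhammer.

(** * Chu-Vandermonde and alternating binomial sums in characteristic zero *)

Section CharZero.
Variable R : numFieldType.
Implicit Types (x y : R) (m n k : nat).

Lemma fact_neq0 n : (n`!%:R : R) != 0.
Proof. by rewrite pnatr_eq0 -lt0n fact_gt0. Qed.

Lemma pochN_neq0 m n : (n <= m)%N -> poch (- m%:R : R) n != 0.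
Proof.
move=> le_nm; have: poch (- m%:R : R) n * (m - n)`!%:R != 0.
  by rewrite pochN_fact // mulf_neq0 ?signr_eq0 ?fact_neq0.
by rewrite mulf_eq0 => /norP[].
Qed.

(** Chu-Vandermonde: [(x)_i / i!] is the coefficient of [t^i] in [(1 - t)^(-x)]. The induction uses
    the recurrence [(i + 1) v_(i+1) = (x + i) v_i] of these coefficients. *)
Lemma poch_vandermonde x y n :
  \sum_(i < n.+1) poch x i / i`!%:R * (poch y (n - i)%N / (n - i)`!%:R)
  = poch (x + y) n / n`!%:R.
Proof.
pose v z i := poch z (Posz i) / i`!%:R : R.
have vS z i : i.+1%:R * v z i.+1 = (z + i%:R) * v z i.
  rewrite /v factS natrM pochSr.
  have := fact_neq0 i; have : i.+1%:R != 0 :> R by rewrite pnatr_eq0.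
  by move: (i.+1%:R : R) (i`!%:R : R) => s f *; field; apply/andP.
rewrite -/(v (x + y) n) -[LHS]/(\sum_(i < n.+1) v x i * v y (n - i)%N).
elim: n => [|n IHn]; first by rewrite big_ord1 /v subn0 !poch0 fact0 divr1 mulr1.
have n1 : n.+1%:R != 0 :> R by rewrite pnatr_eq0.
apply: (mulfI n1); rewrite vS -IHn mulr_sumr.
(* The factor [n + 1] is split as [i + (n + 1 - i)], so that the recurrence applies to one factor of
   each product. *)
transitivity (\sum_(i < n.+2) i%:R * v x i * v y (n.+1 - i)%N +
              \sum_(i < n.+2) v x i * ((n.+1 - i)%:R * v y (n.+1 - i)%N)).
  rewrite -big_split; apply: eq_bigr => i _ /=.
  by rewrite (natrB _ (ltn_ord i : (i <= n.+1)%N)); ring.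
rewrite big_ord_recl mul0r mul0r add0r [X in _ + X]big_ord_recr /= subnn.
rewrite mul0r mulr0 addr0 -big_split mulr_sumr; apply: eq_bigr => i _ /=.
have le_in : (i <= n)%N by rewrite -ltnS.
rewrite /bump add1n subSS vS subSn // vS natrB //; ring.
Qed.

(** Partial fractions of [m! / (y)_(m+1)]. By Pascal's rule the sum for [m + 1] at [y] is the sum
    for [m] at [y] minus the one at [y + 1]. *)
Lemma altern_binomial_inv m y : poch y m.+1 != 0 ->
  \sum_(l < m.+1) (-1) ^+ l * 'C(m, l)%:R / (y + l%:R)
  = m`!%:R / poch y m.+1.
Proof.
elim: m y => [|m IHm] y nz.
  by rewrite big_ord1 pochSr poch0 bin0 !mul1r.
have nz1 : poch y m.+1 != 0 by move: nz; rewrite pochSr mulf_eq0 => /norP[].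
have nz2 : poch (y + 1) m.+1 != 0 by move: nz; rewrite pochSl mulf_eq0 => /norP[].
have nzy : y != 0 by move: nz; rewrite pochSl mulf_eq0 => /norP[].
have nzm : y + m.+1%:R != 0 by move: nz; rewrite pochSr mulf_eq0 => /norP[].
transitivity (\sum_(l < m.+1) (-1) ^+ l * 'C(m, l)%:R / (y + l%:R)
   - \sum_(l < m.+1) (-1) ^+ l * 'C(m, l)%:R / (y + 1 + l%:R)).
  rewrite big_ord_recl bin0 [X in _ = X - _]big_ord_recl bin0 -addrA; congr (_ + _).
  rewrite -sumrN.
  transitivity (\sum_(l < m.+1) ((-1) ^+ l.+1 * 'C(m, l.+1)%:R / (y + l.+1%:R)
     - (-1) ^+ l * 'C(m, l)%:R / (y + 1 + l%:R))).
    apply: eq_bigr => l _; rewrite /= /bump add1n binS natrD -[l.+1]addn1 natrD.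
    by rewrite exprD (_ : y + (l%:R + 1) = y + 1 + l%:R); ring.
  rewrite big_split /= big_ord_recr /= bin_small // mulr0 mul0r addr0.
  by congr (_ + _); apply: eq_bigr => l _.
rewrite !IHm //.
have e : poch y m.+1 = y * poch (y + 1) m.+1 / (y + m.+1%:R).
  by rewrite -pochSl [poch y m.+2]pochSr mulfK.
rewrite e (pochSl y) factS natrM; move: nz2 nzy nzm; set P := poch _ _.
by rewrite -[m.+1]addn1 natrD => *; field; apply/and3P.
Qed.

(** With [p = q X + c], the part [c] is the previous sum. In the part [q X] the factor [l] is
    absorbed by [l C(m+1, l) = (m+1) C(m, l-1)], which leaves the sum for [m] and [q(X + 1)] at
    [y + 1]. *)
Lemma altern_binomial_poly m (p : {poly R}) y :
  (size p <= m.+1)%N -> poch y m.+1 != 0 ->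
  \sum_(l < m.+1) (-1) ^+ l * 'C(m, l)%:R * p.[l%:R] / (y + l%:R)
  = m`!%:R * p.[- y] / poch y m.+1.
Proof.
elim: m p y => [|m IHm] p y sp nz.
  rewrite (size1_polyC sp) big_ord1 !hornerC pochSr poch0 bin0 !mul1r //.
have [q [c ->] sq] : exists q, exists2 c, p = q * 'X + c%:P & (size q <= m.+1)%N.
  exists (drop_poly 1 p); exists p`_0; last first.
    by rewrite size_drop_poly leq_subLR.
  by rewrite -{1}(poly_take_drop 1 p) addrC; congr (_ + _); apply/polyP => i;
     rewrite coef_take_poly coefC; case: i.
have nz2 : poch (y + 1) m.+1 != 0 by move: nz; rewrite pochSl mulf_eq0 => /norP[].
have nzy : y != 0 by move: nz; rewrite pochSl mulf_eq0 => /norP[].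
rewrite !hornerE.
transitivity (c * (\sum_(l < m.+2) (-1) ^+ l * 'C(m.+1, l)%:R / (y + l%:R))
  - m.+1%:R * \sum_(l < m.+1) (-1) ^+ l * 'C(m, l)%:R *
      (q \Po ('X + 1%:P)).[l%:R] / (y + 1 + l%:R)).
  rewrite [in LHS]big_ord_recl [X in c * X]big_ord_recl !hornerE mulrDr -addrA.
  congr (_ + _).
  rewrite !mulr_sumr -sumrN -big_split; apply: eq_bigr => l _ /=.
  rewrite /bump add1n horner_comp !hornerE /= -[y + 1 + _]addrA [1 + _]addrC.
  rewrite -[l%:R + 1](natrD _ l 1) addn1.
  have e : m.+1%:R * 'C(m, l)%:R = l.+1%:R * 'C(m.+1, l.+1)%:R :> R.
    by rewrite -!natrM mul_bin_diag.
  rewrite exprS; set C := 'C(m.+1, _)%:R in e *.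
  set C' := 'C(m, _)%:R in e *.
  transitivity (c * ((-1 * (-1) ^+ l) * C / (y + l.+1%:R)) -
    (-1) ^+ l * (m.+1%:R * C') * q.[l.+1%:R] / (y + l.+1%:R)); last by ring.
  by rewrite e; ring.
rewrite altern_binomial_inv // IHm //; last first.
  by rewrite size_comp_poly2 // size_XaddC.
rewrite horner_comp !hornerE opprD subrK pochSl factS natrM.
move: (poch _ _) nz2 => P nz2 /=; field; exact/andP.
Qed.

End CharZero.

(** * Mixed moments of the weight *)

(** Both sides are the coefficient of [X^N] in [X^l P * X^k Q], with [P] and [Q] the generating
    polynomials of [F] and [G] truncated after degree [N]. *)
Lemma shifted_convolution (R : comNzRingType) (F G : nat -> R) (N l k : nat) :
  \sum_(n < N.+1) (if (l <= n)%N then F (n - l)%N else 0) *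
                  (if (k <= N - n)%N then G (N - n - k)%N else 0)
  = if (l + k <= N)%N then
      \sum_(i < (N - (l + k)).+1) F i * G (N - (l + k) - i)%N
    else 0.
Proof.
pose P := \poly_(i < N.+1) F i; pose Q := \poly_(i < N.+1) G i.
transitivity ((('X^l * P) * ('X^k * Q))`_N).
  rewrite coefM; apply: eq_bigr => n _; rewrite !coefXnM !coef_poly.
  rewrite !ltnNge -!ltnNge !ltnS.
  rewrite (leq_trans (leq_subr l n) (ltn_ord n : (n <= N)%N)).
  rewrite (leq_trans (leq_subr k _) (leq_subr n N)).
  by case: leqP => _; case: leqP.
rewrite mulrACA -exprD coefXnM ltnNge; case: leqP => //= _.
rewrite coefM; apply: eq_bigr => i _; rewrite !coef_poly !ltnS.
rewrite (leq_trans (leq_subr i _) (leq_subr _ N)).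
by rewrite (leq_trans (ltn_ord i : (i <= N - (l + k))%N) (leq_subr _ N)).
Qed.

Section Moments.
Variable R : numFieldType.
Implicit Types (a b : R) (N l k m n : nat).

(** For [l <= n], the first [l] factors of [(1 - a)_n = (-1)^n (a - n)_n] cancel [(a - n)_l]; the
    others give [(1 - a)_(n-l)] up to sign. For [l > n] the factor [(-n)_l] is zero. *)
Lemma weight_shift a n l : poch (a - n%:R) l != 0 ->
  poch (1 - a) n / n`!%:R * (poch (- n%:R) l / poch (a - n%:R) l)
  = if (l <= n)%N then poch (1 - a) (n - l)%N / (n - l)`!%:R else 0.
Proof.
move=> nz; case: leqP => [le_ln | lt_nl]; last by rewrite pochN_eq0 ?mul0r ?mulr0.
have e1 : poch (1 - a) n
    = (-1) ^+ n * (poch (a - n%:R) l * poch (a - n%:R + l%:R) (n - l)%N).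
  rewrite -opprB poch_reflect -pochD subnKC //; congr (_ * poch _ _); ring.
have e2 : poch (1 - a) (n - l)%N
    = (-1) ^+ (n - l) * poch (a - n%:R + l%:R) (n - l)%N.
  by rewrite -opprB poch_reflect natrB //; congr (_ * poch _ _); ring.
have e3 : poch (- n%:R) l = (-1) ^+ l * n`!%:R / (n - l)`!%:R :> R.
  by rewrite -(pochN_fact _ le_ln) mulfK ?fact_neq0.
have e4 : (-1) ^+ n = (-1) ^+ (n - l) * (-1) ^+ l :> R.
  by rewrite -exprD subnK.
have e5 : (-1) ^+ l * (-1) ^+ l = 1 :> R by rewrite -expr2 sqrr_sign.
rewrite e1 e2 e3 e4.
move: (poch _ l) nz (poch _ (n - l)%N) => p nz q.
transitivity (((-1) ^+ l * (-1) ^+ l) * ((-1) ^+ (n - l) * q / (n - l)`!%:R) : R);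
  last by rewrite e5 mul1r.
have := fact_neq0 R n; have := fact_neq0 R (n - l).
by move: n`!%:R (n - l)`!%:R => f g *; field; apply/and3P.
Qed.

Lemma hahn_moment a b N l k : hahn_generic a b N ->
  (l <= N)%N -> (k <= N)%N ->
  \sum_(n < N.+1) hahnW a b N n
     * (poch (- (N%:R - n%:R)) k / poch (b + 2 - a - (N%:R - n%:R)) k)
     * (poch (- n%:R) l / poch (a - n%:R) l)
  = poch (- N%:R) (l + k)%N / poch (b - N%:R + 1) (l + k)%N.
Proof.
move=> gen le_lN le_kN.
pose v x i := poch x (Posz i) / i`!%:R : R.
transitivity (N`!%:R / poch (- b) N * \sum_(n < N.+1)
    (if (l <= n)%N then v (1 - a) (n - l)%N else 0) *
    (if (k <= N - n)%N then v (a - b - 1) (N - n - k)%N else 0)).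
  rewrite mulr_sumr; apply: eq_bigr => n _.
  have le_nN : (n <= N)%N := ltn_ord n.
  rewrite -weight_shift; last exact: gen_U gen _ _ le_nN le_lN.
  (* [V] has the parameter [b + 2 - a] in place of [a], so the same lemma applies to the other half
     of the weight, with [N - n] for [n]. *)
  have -> : a - b - 1 = 1 - (b + 2 - a) by ring.
  rewrite -weight_shift; last first.
    by rewrite natrB //; exact: gen_V gen _ _ le_nN le_kN.
  rewrite /hahnW natrB // subzn // invfM.
  by rewrite (_ : 1 - (b + 2 - a) = a - b - 1); ring.
(* For [l + k > N] the convolution is empty, in agreement with [(-N)_(l+k) = 0]. *)
rewrite shifted_convolution; case: leqP => [le_lkN | lt_Nlk]; last first.
  by rewrite pochN_eq0 // mulr0 mul0r.
(* The two parameters add up to [-b]: here [a] drops out. *)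
rewrite poch_vandermonde (_ : 1 - a + (a - b - 1) = - b); last by ring.
have e1 : poch (- N%:R) (l + k)%N
    = (-1) ^+ (l + k) * N`!%:R / (N - (l + k))`!%:R :> R.
  by rewrite -(pochN_fact _ le_lkN) mulfK ?fact_neq0.
(* The last [l + k] factors of [(-b)_N] are, up to sign, those of [(b - N + 1)_(l+k)]. *)
have eW : poch (- b) N = poch (- b) (N - (l + k))%N *
    ((-1) ^+ (l + k) * poch (b - N%:R + 1) (l + k)%N).
  rewrite -{1}(subnK le_lkN) pochD; congr (_ * _).
  rewrite -(opprK (_ + _)) poch_reflect; congr (_ * poch _ _).
  by rewrite natrB //; ring.
have := gen_W gen; rewrite eW e1 !mulf_eq0 !negb_or.
have := fact_neq0 R (N - (l + k)).
move: ((N - (l + k))`!%:R : R) (N`!%:R : R) => g f ng.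
move: (poch _ (N - (l + k))%N) (poch _ (l + k)%N) => p q /and3P[np ns nq].
have e5 : (-1) ^+ (l + k) * (-1) ^+ (l + k) = 1 :> R by rewrite -expr2 sqrr_sign.
move: ((-1) ^+ (l + k)) ns e5 => s ns e5.
transitivity (f * (s * s) / (g * (s * q))); last by field; apply/and3P.
by rewrite e5 mulr1; field; apply/and4P.
Qed.

(** * The coefficients of [U_m] against the moments *)

Definition pochX (c : R) (n : nat) : {poly R} :=
  \prod_(i < n) ('X + (c + i%:R)%:P).

Lemma size_pochX c n : (size (pochX c n) <= n.+1)%N.
Proof.
elim: n => [|n IHn]; first by rewrite /pochX big_ord0 size_poly1.
rewrite /pochX big_ord_recr /= (leq_trans (size_polyMleq _ _)) //.
by rewrite size_XaddC addn2.
Qed.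

Lemma horner_pochX c n x : (pochX c n).[x] = poch (x + c) n.
Proof.
rewrite horner_prod poch_nat; apply: eq_bigr => i _.
by rewrite hornerD hornerX hornerC addrA.
Qed.

(** The coefficient of [(-x)_l / (a - x)_l] in [U_m], up to the prefactor. It does not contain [a],
    so [V_m] has the same coefficients. *)
Definition hahn_coef b N m l : R :=
  (poch (- m%:R) l * poch (b + m%:R - N%:R) l) / (l`!%:R * poch (- N%:R) l).

(** [(b - N + 1)_N] and [(b + 1)_N] are consecutive blocks of [(b - N + 1)_(2N)]. Indices up to [2N]
    occur because the moments have index [k + l]. *)
Lemma poch_generic a b N j : hahn_generic a b N -> (j <= N + N)%N ->
  poch (b - N%:R + 1) j != 0.
Proof.
move=> gen le_j; have : poch (b - N%:R + 1) (N + N)%N != 0.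
  rewrite pochD mulf_neq0 ?(gen_h gen) //.
  by rewrite addrAC subrK (gen_b1 gen).
by rewrite -(subnKC le_j) pochD mulf_eq0 => /norP[].
Qed.

(* With [y = b + m - N], the summand is [(-1)^l 'C(m, l) p(l) / (y + l)] for a
   polynomial [p] of degree [m], and [p(-y) = 0] unless [k = m]. *)
Lemma hahn_coef_moment a b N m k : hahn_generic a b N ->
  (k <= m)%N -> (m <= N)%N ->
  \sum_(l < m.+1) hahn_coef b N m l *
     (poch (- N%:R) (k + l)%N / poch (b - N%:R + 1) (k + l)%N)
  = (k == m)%:R *
    (m`!%:R * (-1) ^+ m * poch (b + 1) m / poch (b - N%:R + 1) (m + m)%N).
Proof.
(* The case [m = 0] is separate: there [y = b - N], which genericity does not force to be
   nonzero. *)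
move=> gen; case: m => [|m] le_km le_mN.
  move: le_km; rewrite leqn0 => /eqP ->; rewrite big_ord1 /hahn_coef !poch0.
  by rewrite fact0 expr0 !(mulr1, divr1).
have nzz j : (j <= N + N)%N -> poch (b - N%:R + 1) j != 0 by apply: poch_generic gen.
set y := b + m.+1%:R - N%:R; set z := b - N%:R + 1 in nzz *.
have zy : z + m%:R = y by rewrite /z /y -[m.+1]addn1 natrD; ring.
have le_mm : (m + m.+2 <= N + N)%N by rewrite addnS -addSn leq_add.
have nzy : poch y m.+2 != 0.
  by move: (nzz _ le_mm); rewrite pochD zy mulf_eq0 => /norP[].
(* At [l] the first factor is [(-N)_(k+l) / (-N)_l]; the second is what remains of [(z)_(m+1+l)]
   after division by [(z)_(k+l)]. The degrees add up to [m + 1]. *)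
pose p := pochX (- N%:R) k * pochX (z + k%:R) (m.+1 - k)%N.
have sp : (size p <= m.+2)%N.
  apply: leq_trans (size_polyMleq _ _) _.
  have := leq_add (size_pochX (- N%:R) k) (size_pochX (z + k%:R) (m.+1 - k)).
  by rewrite addSn addnS subnKC //; case: (_ + _)%N.
transitivity (y / poch z m.+1 * \sum_(l < m.+2)
    (-1) ^+ l * 'C(m.+1, l)%:R * p.[l%:R] / (y + l%:R)).
  rewrite mulr_sumr; apply: eq_bigr => l _.
  have le_lm : (l <= m.+1)%N := ltn_ord l.
  have nyl : y + l%:R != 0.
    by move: nzy; rewrite poch_nat => /prodf_neq0 /(_ l); apply.
  rewrite /hahn_coef -/y hornerM !horner_pochX.
  have e1 : poch (- m.+1%:R) l = (-1) ^+ l * 'C(m.+1, l)%:R * l`!%:R :> R.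
    have := bin_fact le_lm => /(congr1 (fun i => i%:R : R)).
    rewrite natrM natrM => e; apply: (mulIf (fact_neq0 R (m.+1 - l))).
    by rewrite pochN_fact // -e; ring.
  have e2 : poch (- N%:R) (k + l)%N = poch (- N%:R) l * poch (- N%:R + l%:R) k :> R.
    by rewrite addnC pochD.
  (* Both sides equal [y (z)_(m+1+l)], because [y + 1 = z + m + 1]. *)
  have e3 : poch y l * poch z m.+1 * (y + l%:R) =
      y * poch z (k + l)%N * poch (l%:R + (z + k%:R)) (m.+1 - k)%N.
    rewrite -mulrA (_ : l%:R + _ = z + (k + l)%:R); last by rewrite natrD; ring.
    rewrite -[in RHS]mulrA -pochD addnAC subnKC // pochD.
    by rewrite mulrCA mulrC -pochSr pochSl -zy -natr1 addrA; ring.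
  have nl := fact_neq0 R l; have nN := pochN_neq0 R (leq_trans le_lm le_mN).
  have nz1 : poch z m.+1 != 0 by apply: nzz; rewrite (leq_trans le_mN) ?leq_addr.
  have nz2 : poch z (k + l)%N != 0.
    by apply: nzz; rewrite leq_add ?(leq_trans _ le_mN).
  have -> : poch y l = y * poch z (k + l)%N
      * poch (l%:R + (z + k%:R)) (m.+1 - k)%N / (poch z m.+1 * (y + l%:R)).
    by rewrite -e3 -mulrA mulfK ?mulf_neq0.
  rewrite e1 e2 [l%:R - _]addrC; move: (y + l%:R) nyl => w nw.
  move: (poch _ m.+1) (poch _ (k + l)%N) (poch _ l) nz1 nz2 nN => z1 z2 t nz1 nz2 nt.
  by field; apply/and5P.
rewrite altern_binomial_poly // hornerM !horner_pochX.
case: (eqVneq k m.+1) => [-> | ne_km]; last first.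
  have lt_km : (k < m.+1)%N by rewrite ltn_neqAle ne_km.
  (* At [-y] the second factor of [p] becomes [(-(m - k))_(m+1-k) = 0]. *)
  have -> : - y + (z + k%:R) = - (m - k)%:R.
    by rewrite natrB // -zy; ring.
  by rewrite pochN_eq0 ?subSn // !(mulr0, mul0r).
rewrite subnn poch0 mulr1 mul1r.
(* For [k = m + 1] only the first factor of [p] is left; at [-y] it reflects to [(b + 1)_(m+1)] up
   to sign. *)
have -> : - y - N%:R = - (b + m.+1%:R) by rewrite /y; ring.
have := nzz (m.+1 + m.+1)%N (leq_add le_mN le_mN); move: nzy.
rewrite poch_reflect addrK pochD -natr1 addrA zy (pochSl y) !mulf_eq0 !negb_or.
move: (poch (b + 1) _) (poch z _) (poch (y + 1) _) => p1 p2 p3.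
by move=> /andP[ny _] /andP[np2 np3]; field; apply/and3P.
Qed.

End Moments.

(** * The first biorthogonality relation *)

Section Biorthogonality.
Variable R : numFieldType.
Implicit Types (a b x : R) (N m n : nat).

Definition hahn_lead b N m : R := (-1) ^+ m * poch (- N%:R) m / poch (b + 1) m.

Lemma hahnU_coef m x a b N :
  hahnU m x a b N = hahn_lead b N m *
    \sum_(l < m.+1) hahn_coef b N m l * (poch (- x) l / poch (a - x) l).
Proof.
congr (_ * _); apply: eq_bigr => l _.
by rewrite /hahn_coef !invfM; ring.
Qed.

(** Reduces the relation to a bilinear form in the coefficients, whose kernel depends on [k + l]
    only and is thus symmetric. *)
Lemma hahn_gram a b N m m' : hahn_generic a b N -> (m <= N)%N -> (m' <= N)%N ->
  \sum_(n < N.+1) hahnW a b N n * hahnV m n%:R a b N * hahnU m' n%:R a b N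
  = hahn_lead b N m * hahn_lead b N m' * \sum_(k < m.+1) \sum_(l < m'.+1)
      hahn_coef b N m k * hahn_coef b N m' l *
      (poch (- N%:R) (k + l)%N / poch (b - N%:R + 1) (k + l)%N).
Proof.
move=> gen le_mN le_m'N.
transitivity (hahn_lead b N m * hahn_lead b N m' *
    \sum_(k < m.+1) \sum_(l < m'.+1) \sum_(n < N.+1)
      hahn_coef b N m k * hahn_coef b N m' l * (hahnW a b N n
      * (poch (- (N%:R - n%:R)) k / poch (b + 2 - a - (N%:R - n%:R)) k)
      * (poch (- n%:R) l / poch (a - n%:R) l))); last first.
  congr (_ * _); apply: eq_bigr => k _; apply: eq_bigr => l _.
  rewrite -mulr_sumr addnC hahn_moment //.
    exact: leq_trans (ltn_ord l : (l <= m')%N) le_m'N.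
  exact: leq_trans (ltn_ord k : (k <= m)%N) le_mN.
under [in RHS]eq_bigr do rewrite exchange_big.
rewrite exchange_big mulr_sumr; apply: eq_bigr => n _.
rewrite /hahnV !hahnU_coef.
rewrite [LHS](_ : _ = hahn_lead b N m * hahn_lead b N m' * (hahnW a b N n *
  ((\sum_(k < m.+1) hahn_coef b N m k *
     (poch (- (N%:R - n%:R)) k / poch (b + 2 - a - (N%:R - n%:R)) k)) *
   (\sum_(l < m'.+1) hahn_coef b N m' l *
     (poch (- n%:R) l / poch (a - n%:R) l))))); last by ring.
congr (_ * _); rewrite mulr_suml mulr_sumr; apply: eq_bigr => k _.
rewrite mulr_sumr mulr_sumr; apply: eq_bigr => l _; ring.
Qed.

(** Each inner sum vanishes on its own, since [k <= m < m']. *)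
Lemma hahn_biorthogonal_lt a b N m m' : hahn_generic a b N ->
  (m < m')%N -> (m' <= N)%N ->
  \sum_(k < m.+1) \sum_(l < m'.+1) hahn_coef b N m k * hahn_coef b N m' l *
      (poch (- N%:R) (k + l)%N / poch (b - N%:R + 1) (k + l)%N) = 0.
Proof.
move=> gen lt_mm' le_m'N; apply: big1 => k _.
have lt_km' : (k < m')%N := leq_trans (ltn_ord k) lt_mm'.
under eq_bigr do rewrite -mulrA; rewrite -mulr_sumr.
by rewrite (hahn_coef_moment gen) ?(ltnW lt_km') // (ltn_eqF lt_km') mul0r mulr0.
Qed.

(** Removes the integer index: with [z = b - N + 1], either sign of [N - 2m] gives the quotient of
    [(z)_N] by [(z)_(2m)]. *)
Lemma poch_generic_shift a b N m : hahn_generic a b N -> (m <= N)%N ->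
  poch (2 * m%:R - N%:R + b + 1) (N%:Z - (2 * m)%N%:Z)
  = poch (b - N%:R + 1) N / poch (b - N%:R + 1) (m + m)%N.
Proof.
move=> gen le_mN; set z := b - N%:R + 1.
have -> : 2 * m%:R - N%:R + b + 1 = z + (m + m)%N%:R by rewrite natrD /z; ring.
have nz j : (j <= N + N)%N -> poch z j != 0 by apply: poch_generic gen.
rewrite mul2n -addnn; case: (leqP (m + m) N) => [le_mmN | /ltnW le_Nmm].
  rewrite subzn // -{2}(subnKC le_mmN) pochD mulrC mulKf //.
  by apply: nz; rewrite leq_add.
have := nz _ (leq_add le_mN le_mN).
rewrite -(subnKC le_Nmm) pochD mulf_eq0 negb_or => /andP[nz1 nz2].
by rewrite poch_subz // invfM mulVKf.
Qed.

Lemma hahn_biorthogonal a b N m m' : hahn_generic a b N ->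
  (m <= N)%N -> (m' <= N)%N ->
  \sum_(n < N.+1) hahnW a b N n * hahnV m n%:R a b N * hahnU m' n%:R a b N
  = hahn_h b N m * (m == m')%:R.
Proof.
move=> gen le_mN le_m'N; rewrite hahn_gram //.
case: (ltngtP m m') => [lt_mm' | lt_m'm | <-].
- by rewrite (hahn_biorthogonal_lt gen) // !mulr0.
(* The symmetry of the kernel turns this case into the previous one. *)
- rewrite exchange_big /=; under eq_bigr do under eq_bigr do
    rewrite addnC [hahn_coef b N m _ * _]mulrC.
  by rewrite (hahn_biorthogonal_lt gen) // !mulr0.
rewrite mulr1; under eq_bigr => k _.
  under eq_bigr do rewrite -mulrA.
  rewrite -mulr_sumr (hahn_coef_moment gen) //; last exact: (ltn_ord k : (k <= m)%N).
  over.
rewrite big_ord_recr big1 /= ?add0r ?eqxx; last first.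
  by move=> k _; rewrite (ltn_eqF (ltn_ord k)) mul0r mulr0.
rewrite /hahn_lead /hahn_coef /hahn_h (poch_generic_shift gen) //.
rewrite /pochs !big_cons big_nil poch1 mulr1 mul1r.
rewrite (_ : m%:R - N%:R + b = b + m%:R - N%:R); last by ring.
have -> : poch (- m%:R) m = (-1) ^+ m * m`!%:R :> R.
  by rewrite -pochN_fact // subnn fact0 mulr1.
have := poch_generic gen (leq_add le_mN le_mN); have := gen_h gen.
have := gen_b1 gen le_mN; have := pochN_neq0 R le_mN; have := fact_neq0 R m.
have : (-1) ^+ m * (-1) ^+ m = 1 :> R by rewrite -expr2 sqrr_sign.
move: (poch (b - N%:R + 1) N) (poch (b - N%:R + 1) (m + m)%N) => z1 z2.
move: (poch (b + 1) m) (poch (- N%:R) m) (m`!%:R) => u v f.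
move: ((-1) ^+ m) (poch _ m) => s w ss nf nv nu nz1 nz2.
(* The four signs come from the two prefactors, from [(-m)_m] and from the moment sum. *)
transitivity (s * s * (s * s) * (f * v * w / (u * z2))).
  by field; apply/and4P.
by rewrite ss; field; apply/and3P.
Qed.

(** * The dual relation *)

(** The product is free of [n] and is the same constant as [hahnWstar] times [hahn_h]; this converts
    one pair of weight and norm into the other. *)
Lemma hahnW_hstar a b N n : hahn_generic a b N -> (n <= N)%N ->
  hahn_hstar a b N n * hahnW a b N n
  = poch (2 - a + b - N%:R) N / poch (b - N%:R + 1) N.
Proof.
move=> gen le_nN; rewrite /hahn_hstar /hahnW subzn //.
rewrite /pochs !big_cons !big_nil !mulr1 poch1.
set t := 2 - a + b - N%:R.
have -> : poch t N = poch t n * ((-1) ^+ (N - n) * poch (a - b - 1) (N - n)%N).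
  rewrite -{1}(subnKC le_nN) pochD; congr (_ * _).
  rewrite -(opprK (t + _)) poch_reflect; congr (_ * poch _ _).
  by rewrite /t natrB //; ring.
have eN : poch (- b) N = (-1) ^+ (N - n) * (-1) ^+ n * poch (b - N%:R + 1) N.
  by rewrite poch_reflect -exprD subnK.
have eNn : poch (- N%:R) n = (-1) ^+ n * N`!%:R / (N - n)`!%:R :> R.
  by rewrite -(pochN_fact _ le_nN) mulfK ?fact_neq0.
rewrite eN eNn.
have := gen_h gen; have := gen_hstar gen le_nN.
have := fact_neq0 R (N - n); have := fact_neq0 R n; have := fact_neq0 R N.
have := signr_eq0 R n; have := signr_eq0 R (N - n).
have : (-1) ^+ n * (-1) ^+ n = 1 :> R by rewrite -expr2 sqrr_sign.
have : (-1) ^+ (N - n) * (-1) ^+ (N - n) = 1 :> R by rewrite -expr2 sqrr_sign.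
move: ((-1) ^+ (N - n) : R) ((-1) ^+ n : R) => s s'.
move: (poch _ N) (poch _ (N - n)%N) (poch (1 - a) n) (poch t n) => p q r u.
move: (N`!%:R : R) ((N - n)`!%:R : R) (n`!%:R : R) => f g h.
move=> ss ss' /negbT ns /negbT ns' nf nh ng nr np.
transitivity (u * q / (s * (s' * s') * p)).
  by field; do ?[apply/andP; split].
rewrite ss' mulr1 -[u * q]mul1r -ss.
by field; apply/andP.
Qed.

(** The numerator is the denominator of [hahnWstar], so genericity and characteristic zero cover
    it. *)
Lemma hahn_h_neq0 a b N m : hahn_generic a b N -> (m <= N)%N ->
  hahn_h b N m != 0.
Proof.
move=> gen le_mN; rewrite /hahn_h /pochs !big_cons !big_nil !mulr1 poch1.
rewrite !mulf_neq0 ?invr_eq0 ?mulf_neq0 ?fact_neq0 ?pochN_neq0 //.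
- by rewrite addrAC (gen_WstarL gen).
- by rewrite (addrAC (2 * _)) (gen_WstarR gen).
- exact: gen_b1 gen _ le_mN.
- exact: gen_h gen.
Qed.

Lemma hahnWstar_h a b N m : hahn_generic a b N -> (m <= N)%N ->
  hahnWstar a b N m
  = poch (2 - a + b - N%:R) N / poch (b - N%:R + 1) N / hahn_h b N m.
Proof.
move=> gen le_mN; rewrite /hahnWstar /hahn_h (addrAC m%:R b) (addrAC (2 * _) b).
by rewrite !invfM !invrK -[LHS](mulVKf (gen_h gen)); ring.
Qed.

Lemma hahn_biorthogonal_dual a b N (n n' : 'I_N.+1) : hahn_generic a b N ->
  \sum_(m < N.+1) hahnWstar a b N m * hahnV m n%:R a b N * hahnU m n'%:R a b N
  = hahn_hstar a b N n * (n == n')%:R.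
Proof.
move=> gen; have le_ord (i : 'I_N.+1) : (i <= N)%N := ltn_ord i.
(* Dividing by [hahn_h] normalizes the first relation to [A B = 1]. *)
pose A : 'M[R]_N.+1 := \matrix_(m, i)
  (hahnW a b N i * hahnV m i%:R a b N / hahn_h b N m).
pose B : 'M[R]_N.+1 := \matrix_(i, m) hahnU m i%:R a b N.
have /mulmx1C/matrixP BA1 : A *m B = 1%:M.
  apply/matrixP => m m'; rewrite !mxE -[m == m']val_eqE.
  rewrite -[RHS](mulKf (hahn_h_neq0 gen (le_ord m))) -(hahn_biorthogonal gen) ?le_ord //.
  by rewrite mulr_sumr; apply: eq_bigr => i _; rewrite !mxE; ring.
(* [U] is taken at the row index and [V] at the column index of [B A]; multiplying by [hahn_hstar]
   at [n] turns [hahnW / hahn_h] into [hahnWstar]. *)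
have := BA1 n' n; rewrite !mxE eq_sym => <-; rewrite mulr_sumr; apply: eq_bigr => m _.
rewrite !mxE (hahnWstar_h gen) // -(hahnW_hstar gen (le_ord n)); ring.
Qed.

End Biorthogonality.

Theorem proposition5 (R : realFieldType) (N : nat) (a b : R)
    (hgen : hahn_generic a b N) :
  (forall m m' : 'I_N.+1,
     \sum_(n < N.+1)
        hahnW a b N n * hahnV m n%:R a b N * hahnU m' n%:R a b N
     = hahn_h b N m * (m == m')%:R) /\
  (forall n n' : 'I_N.+1,
     \sum_(m < N.+1)
        hahnWstar a b N m * hahnV m n%:R a b N * hahnU m n'%:R a b N
     = hahn_hstar a b N n * (n == n')%:R).
Proof.
split=> [m m' | n n']; last exact: hahn_biorthogonal_dual.
by apply: hahn_biorthogonal => //; rewrite -ltnS.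
Qed.
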